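(* Let $q$ be a prime power. If there exists an $[n,k,d]_q$ LCD code $C$, then there exist $[[n,k,d;n-k]]_q$ and $[[n,n-k,d^{\perp};k]]_q$ maximal-entanglement EAQECCs, where $d^{\perp}$ is the minimum distance of $C^{\perp}$.
   Context: An $[n,k,d]_q$ linear code is a $k$-dimensional subspace of $\mathbb{F}_q^n$ with minimum Hamming distance $d$. The Euclidean dual is $C^{\perp}=\{v\in\mathbb{F}_q^n : \sum_i v_iw_i=0\ \forall w\in C\}$. A linear code $C$ is LCD (linear with complementary dual) if $C\cap C^{\perp}=\{0\}$. An $[[n,k,d;c]]_q$ entanglement-assisted quantum error-correcting code (EAQECC) encodes $k$ logical qudits into $n$ physical qudits using $c$ copies of maximally entangled states pre-shared between sender and receiver. In standard terms: with $\mathcal{H}=\mathbb{C}^q$ and $\Phi=q^{-1/2}\sum_{i}|i\rangle|i\rangle\in\mathcal{H}\otimes\mathcal{H}$, it is a subspace $Q=\{(U\otimes I)(|\psi\rangle\otimes|0\rangle^{\otimes (n-k-c)}\otimes\Phi^{\otimes c}):\psi\in\mathcal{H}^{\otimes k}\}$ of $\mathcal{H}^{\otimes n}\otimes\mathcal{H}^{\otimes c}$, where $U$ is a unitary on the sender's $n$ qudits (the $k$ data qudits, the $n-k-c$ ancillas and the sender's halves of the $c$ pairs) and $I$ acts on the receiver's $c$ halves, such that, with $P$ the orthogonal projector onto $Q$, for every operator $E$ on $\mathcal{H}^{\otimes n}$ acting nontrivially on at most $d-1$ qudits there is a scalar $\lambda_E$ with $P(E\otimes I)P=\lambda_E P$.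 An EAQECC $[[n,2\kappa-n+c,d;c]]_q$ obtained from a classical $[n,\kappa]$ code is called maximal-entanglement if $c=n-\kappa$; equivalently, an $[[n,k,d;c]]_q$ EAQECC is maximal-entanglement if $c=n-k$. *)

(* Defs.v *)
From HB Require Import structures.
From mathcomp Require Import all_boot all_order all_algebra all_field.
From mathcomp Require Import reals complex.

Set Implicit Arguments.
Unset Strict Implicit.
Unset Printing Implicit Defensive.

Import GRing.Theory Num.Theory.
Local Open Scope ring_scope.

Section LinearCodes.

Variables (F : finFieldType) (n : nat).
Implicit Types (C : {vspace 'rV[F]_n}) (x y v w : 'rV[F]_n).

Definition hamming x y : nat := #|[set i | x 0 i != y 0 i]|.

(* The zero code has no minimum distance in this sense. *)
Definition min_distance C (d : nat) : Prop :=
  (exists x y, [/\ x \in C, y \in C, x != y & hamming x y = d]) /\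
  (forall x y, x \in C -> y \in C -> x != y -> (d <= hamming x y)%N).

Definition linear_code (k d : nat) C : Prop :=
  \dim C = k /\ min_distance C d.

Definition dual_code C : {vspace 'rV[F]_n} :=
  (\bigcap_(w | w \in C) lker (linfun (mulmxr (w^T : 'M_(n, 1)))))%VS.

Lemma mem_dual_code C v :
  v \in dual_code C <-> (forall w, w \in C -> \sum_i v 0 i * w 0 i = 0).
Proof.
have dotE w : (linfun (mulmxr (w^T : 'M_(n, 1))) v == 0) =
    (\sum_i v 0 i * w 0 i == 0).
  rewrite lfunE /=; apply/eqP/eqP => [/matrixP/(_ 0 0)|vw0].
    by rewrite !mxE => vw0; rewrite -[RHS]vw0; apply: eq_bigr => i _; rewrite mxE.
  apply/matrixP => i j; rewrite !ord1 !mxE -[RHS]vw0.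
  by apply: eq_bigr => l _; rewrite mxE.
rewrite /dual_code memvE; split=> [/subv_bigcapP vC w wC|vC].
  by apply/eqP; rewrite -dotE -memv_ker memvE vC.
by apply/subv_bigcapP => w wC; rewrite -memvE memv_ker dotE vC.
Qed.

Definition lcd C : Prop := (C :&: dual_code C = 0)%VS.

End LinearCodes.

Section HilbertSpaces.

Variable K : numClosedFieldType.

(* The space K^T with orthonormal basis indexed by T, so that
   K^A (x) K^B is hilb (A * B). *)
Definition hilb (T : finType) := {ffun T -> K^o}.

Definition ket (T : finType) (t : T) : hilb T := [ffun s => (s == t)%:R].

Definition dotp (T : finType) (u v : hilb T) : K := \sum_t (u t)^* * v t.

Definition unitary (T : finType) (U : 'End(hilb T)) : Prop :=
  (forall u v, dotp (U u) (U v) = dotp u v) /\ (forall v, exists u, U u = v).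

Definition orth_projector (T : finType) (Q : {vspace hilb T})
    (P : 'End(hilb T)) : Prop :=
  forall v, P v \in Q /\ (forall w, w \in Q -> dotp w (v - P v) = 0).

(* X (x) I on K^A (x) K^B *)
Definition tensI (A B : finType) (X : 'End(hilb A)) : 'End(hilb (A * B)%type) :=
  linfun (fun f : hilb (A * B)%type =>
    [ffun ab => X [ffun a => f (a, ab.2)] ab.1] : hilb (A * B)%type).

Lemma tensIE (A B : finType) (X : 'End(hilb A)) (f : hilb (A * B)%type) a b :
  tensI B X f (a, b) = X [ffun a' => f (a', b)] a.
Proof.
pose g (f : hilb (A * B)%type) : hilb (A * B)%type :=
  [ffun ab => X [ffun a => f (a, ab.2)] ab.1].
have g_lin : linear g.
  move=> c u v; apply/ffunP => ab; rewrite !ffunE.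
  have -> : [ffun a => (c *: u + v) (a, ab.2)] =
      c *: ([ffun a => u (a, ab.2)] : hilb A) + [ffun a => v (a, ab.2)].
    by apply/ffunP => a'; rewrite !ffunE.
  by rewrite linearP !ffunE.
pose mx := GRing.isLinear.Build _ _ _ _ g g_lin.
pose gl : {linear hilb (A * B)%type -> hilb (A * B)%type} :=
  HB.pack g mx.
by rewrite /tensI -/g (lfunE gl) /= /g ffunE.
Qed.

Lemma tensI_tensor (A B : finType) (X : 'End(hilb A)) (u : hilb A) (v : hilb B) :
  tensI B X [ffun ab => u ab.1 * v ab.2] = [ffun ab => X u ab.1 * v ab.2].
Proof.
apply/ffunP => -[a b]; rewrite tensIE ffunE /=.
have -> : [ffun a' => [ffun ab => u ab.1 * v ab.2] (a', b)] = v b *: u.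
  by apply/ffunP => a'; rewrite !ffunE /= mulrC.
by rewrite linearZ !ffunE mulrC.
Qed.

End HilbertSpaces.

Section QuantumCodes.

Variables (K : numClosedFieldType) (q : nat).

Definition word (I : finType) := {ffun I -> 'I_q}.

(* (K^q)^{(x) I}, with one qudit for each element of I *)
Definition qudits (I : finType) := hilb K (word I).

Definition restr (I : finType) (S : {set I}) (x : word I) :
  word {i | i \in S} := [ffun i => x (val i)].

(* E = A (x) I, with A on the qudits in S, written with the matrix
   coefficients <x|E|y>. *)
Definition supported_on (I : finType) (S : {set I}) (E : 'End(qudits I)) : Prop :=
  exists A : 'End(qudits {i | i \in S}), forall x y : word I,
    E (ket K y) x =
    A (ket K (restr S y)) (restr S x) * [forall i in ~: S, x i == y i]%:R.

(* Coefficients of |0> on |s>, and of q^(-1/2) \sum_i |i>|i> on |s>|t> *)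
Definition ket0 (s : 'I_q) : K := (s == 0 :> nat)%:R.
Definition Phi (s t : 'I_q) : K := (sqrtC q%:R)^-1 * (s == t)%:R.

(* |psi> (x) |0>^{(x) a} (x) Phi^{(x) c}: of the sender's n = k + a + c qudits,
   the first k are the data, the next a are the ancillas, and the last c are the
   sender's halves of the pairs; the second factor is the receiver's. *)
Definition initial_state (n k a c : nat) (eqn : (k + a + c)%N = n)
    (psi : qudits 'I_k) : hilb K (word 'I_n * word 'I_c)%type :=
  [ffun xy : word 'I_n * word 'I_c =>
     psi [ffun i => xy.1 (cast_ord eqn (lshift c (lshift a i)))] *
     (\prod_(i < a) ket0 (xy.1 (cast_ord eqn (lshift c (rshift k i))))) *
     (\prod_(j < c) Phi (xy.1 (cast_ord eqn (rshift (k + a) j))) (xy.2 j))].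

Definition eaqecc (n k d c : nat)
    (Q : {vspace hilb K (word 'I_n * word 'I_c)%type}) : Prop :=
  (exists (a : nat) (eqn : (k + a + c)%N = n) (U : 'End(qudits 'I_n)),
     unitary U /\
     (forall phi, phi \in Q <->
        exists psi, phi = tensI (word 'I_c) U (initial_state eqn psi))) /\
  (exists P, orth_projector Q P /\
     (forall (S : {set 'I_n}) (E : 'End(qudits 'I_n)),
        (#|S| < d)%N -> supported_on S E ->
        exists lam : K, (P \o tensI (word 'I_c) E \o P = lam *: P)%VF)).

Definition maximal_entanglement (n k d c : nat)
    (Q : {vspace hilb K (word 'I_n * word 'I_c)%type}) : Prop :=
  eaqecc k d Q /\ c = (n - k)%N.

End QuantumCodes.

(* Main.v *)
(* Since C is LCD, F^n is the direct sum of C and its dual D = C^perp, so with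
   f and h enumerating C and D the map (x, y) |-> f x + h y permutes the basis
   states of n qudits.  Sending x to q^(-c/2) \sum_y |f x + h y>|y>, c = \dim D,
   needs no ancilla and c pairs.  For an operator A (x) I supported on S with
   |S| < d, the matrix entry between x and x' is q^(-c) times a sum over y of
   terms vanishing unless f x and f x' agree off S, i.e. unless x = x', by the
   minimum distance.  On the diagonal, no nonzero word of C = D^perp is supported
   on S, so D maps onto F^S: some w in D agrees with f x' - f x on S, and the
   shift h y |-> h y + w shows that the entry does not depend on x.  The second
   code comes from applying this to D, which is again LCD, with dual C. *)
From HB Require Import structures.
Require Import Defs.
From mathcomp Require Import all_boot all_order all_algebra all_field.
From mathcomp Require Import reals complex.

Set Implicit Arguments.
Unset Strict Implicit.
Unset Printing Implicit Defensive.

Import GRing.Theory Num.Theory.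
Local Open Scope ring_scope.

(** * Duality and interpolation for LCD codes *)

Section LcdCodes.

Variables (F : finFieldType) (n : nat).
Implicit Types (C D : {vspace 'rV[F]_n}).

Lemma dim_full_rV m : \dim {: 'rV[F]_m} = m.
Proof. by rewrite dimvf /dim /= mul1n. Qed.

(** Rank-nullity for v |-> v B, where the columns of [B] are a basis of C: the kernel lies in the
    dual and the image has dimension at most dim C. *)
Lemma dim_dual_code_ge C : (n <= \dim C + \dim (dual_code C))%N.
Proof.
pose B : 'M[F]_(n, \dim C) := \matrix_(i, j) (vbasis C)`_j 0 i.
pose f := linfun (mulmxr B : 'rV_n -> 'rV_(\dim C)).
have kerf : (lker f <= dual_code C)%VS.
  apply/subvP => v; rewrite memv_ker lfunE /= => /eqP vB0.
  apply/mem_dual_code => w /coord_vbasis ->.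
  under eq_bigr => i _ do rewrite summxE mulr_sumr.
  rewrite exchange_big big1 //= => j _.
  transitivity (coord (vbasis C) j w * (v *m B) 0 j); last by rewrite vB0 mxE mulr0.
  by rewrite mxE mulr_sumr; apply: eq_bigr => i _; rewrite !mxE mulrCA.
rewrite -[X in (X <= _)%N]dim_full_rV -(limg_ker_dim f) capfv addnC.
by rewrite leq_add ?dimvS // -[X in (_ <= X)%N]dim_full_rV dimvS ?subvf.
Qed.

Lemma dual_code_eq0 C : dual_code C = 0%VS -> C = fullv.
Proof.
move=> C0; apply/eqP; rewrite eqEdim subvf dim_full_rV.
by have := dim_dual_code_ge C; rewrite C0 dimv0 addn0.
Qed.

Lemma dual_code_sym C D : (C <= dual_code D)%VS -> (D <= dual_code C)%VS.
Proof.
move=> /subvP CD; apply/subvP => v vD; apply/mem_dual_code => w /CD.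
move=> /mem_dual_code/(_ v vD) wv0; rewrite -[RHS]wv0.
by apply: eq_bigr => i _; rewrite mulrC.
Qed.

(** Formal consequence of the Galois connection [dual_code_sym]; no dimension count enters. *)
Lemma dual_codeD C D :
  dual_code (C + D)%VS = (dual_code C :&: dual_code D)%VS.
Proof.
apply/eqP; rewrite eqEsubv subv_cap; apply/andP; split.
  apply/andP; split; apply: dual_code_sym; apply: (subv_trans _ (dual_code_sym (subvv _))).
    exact: addvSl.
  exact: addvSr.
apply: dual_code_sym; rewrite subv_add.
by rewrite dual_code_sym ?capvSl // dual_code_sym ?capvSr.
Qed.

(** By dimension, C + C^perp is the full space, so its dual, the intersection of C^perp and its own
    dual, is zero. Hence the dimensions of C^perp and of its dual add up to at most n, which leaves
    the double dual no room beyond C. *)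
Lemma lcd_dual_codeK C : lcd C -> dual_code (dual_code C) = C.
Proof.
move=> lcdC.
have dual0 : (dual_code C :&: dual_code (dual_code C) = 0)%VS.
  apply/eqP; rewrite -dual_codeD -subv0; apply/subvP => v.
  have -> : (C + dual_code C)%VS = fullv.
    apply/eqP; rewrite eqEdim subvf dim_full_rV.
    by rewrite dimv_disjoint_sum // dim_dual_code_ge.
  move/mem_dual_code => v0; rewrite memv0; apply/eqP/rowP => i; rewrite mxE.
  have := v0 (delta_mx 0 i) (memvf _); rewrite (bigD1 i) //= mxE !eqxx mulr1.
  rewrite big1 ?addr0 // => j /negPf ji.
  by rewrite mxE ji andbF mulr0.
have CC : (C <= dual_code (dual_code C))%VS by apply: dual_code_sym.
apply/eqP; rewrite eq_sym eqEdim CC /=.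
rewrite -(leq_add2l (\dim (dual_code C))) -dimv_disjoint_sum //.
rewrite (leq_trans (dimvS (subvf _))) // dim_full_rV addnC.
exact: dim_dual_code_ge.
Qed.

Lemma lcd_dual_code C : lcd C -> lcd (dual_code C).
Proof. by move=> lcdC; rewrite /lcd lcd_dual_codeK // capvC. Qed.

Lemma dim_lcd_dual_code C : lcd C -> (\dim C + \dim (dual_code C) = n)%N.
Proof.
move=> lcdC; apply/eqP; rewrite eqn_leq dim_dual_code_ge andbT.
rewrite -dimv_disjoint_sum //.
by rewrite (leq_trans (dimvS (subvf _))) // dim_full_rV.
Qed.

Lemma min_distance_eq C d (S : {set 'I_n}) (v w : 'rV[F]_n) :
  min_distance C d -> (#|S| < d)%N -> v \in C -> w \in C ->
  (forall i, i \notin S -> v 0 i = w 0 i) -> v = w.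
Proof.
case=> _ dC Sd vC wC vwS; apply/eqP; apply: contraLR Sd => vw.
rewrite -leqNgt (leq_trans (dC v w vC wC vw)) //.
apply/subset_leq_card/subsetP => i; rewrite inE.
by apply: contraR => /vwS ->.
Qed.

(* No nonzero word of C = (C^perp)^perp is supported on S, so C^perp and the
   words vanishing on S together have zero dual. *)
Lemma lcd_dual_code_interpolation C d (S : {set 'I_n}) (v : 'rV[F]_n) :
  lcd C -> min_distance C d -> (#|S| < d)%N ->
  exists2 w, w \in dual_code C & forall i, i \in S -> w 0 i = v 0 i.
Proof.
move=> lcdC dC Sd.
pose pr := mulmxr (diag_mx (\row_i (i \in S)%:R)) : 'rV[F]_n -> 'rV_n.
pose N := lker (linfun pr).
have prE x i : pr x 0 i = x 0 i * (i \in S)%:R by rewrite /pr /= mul_mx_diag !mxE.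
have : v \in (dual_code C + N)%VS.
  suff -> : (dual_code C + N)%VS = fullv by apply: memvf.
  apply: dual_code_eq0; rewrite dual_codeD lcd_dual_codeK //.
  apply/eqP; rewrite -subv0; apply/subvP => u /memv_capP[uC /mem_dual_code uN].
  rewrite memv0; apply/eqP; apply: (min_distance_eq dC Sd) => // [|i iS].
    exact: mem0v.
  (* Unit vectors at positions outside [S] vanish on [S]; testing [u] against them shows that [u] is
     supported on [S]. *)
  have : delta_mx 0 i \in N.
    rewrite memv_ker lfunE; apply/eqP/rowP => j; rewrite [LHS]prE !mxE /=.
    by have [->|] := eqVneq j i; rewrite ?(negPf iS) ?mulr0 ?mul0r.
  move/uN; rewrite (bigD1 i) //= mxE !eqxx mulr1 big1 ?addr0 ?mxE // => j /negPf ji.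
  by rewrite mxE ji andbF mulr0.
case/memv_addP => w wC [z zN ->]; exists w => // i iS.
move: zN; rewrite memv_ker lfunE => /eqP/rowP/(_ i).
by rewrite [LHS]prE !mxE iS mulr1 => ->; rewrite addr0.
Qed.

(** Coordinates in a basis of C, with field elements relabelled by [enum_val] because qudit symbols
    are ordinals. *)
Lemma vspace_param C (k : nat) : \dim C = k ->
  exists2 f : word #|F| 'I_k -> 'rV[F]_n,
    injective f & forall v, (v \in C) <-> exists x, f x = v.
Proof.
move=> <-; exists (fun x : word #|F| 'I_(\dim C) => \sum_i enum_val (x i) *: (vbasis C)`_i).
  move=> x y xy; apply/ffunP => i; apply: enum_val_inj.
  have fC := basis_free (vbasisP C).
  by rewrite -(coord_sum_free (fun i => enum_val (x i)) i fC) xy coord_sum_free.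
move=> v; split=> [vC|[x <-]].
  exists [ffun i => enum_rank (coord (vbasis C) i v)].
  rewrite [RHS](coord_vbasis vC); apply: eq_bigr => i _.
  by rewrite ffunE enum_rankK.
apply: memv_suml => i _; apply/memvZ/vbasis_mem/mem_nth.
by rewrite size_tuple.
Qed.

End LcdCodes.

(** * Operators given by matrix entries, projectors and permutation unitaries *)

Section Kernels.

Variable K : numClosedFieldType.

Section KernelOp.

Variables (A B : finType) (M : B -> A -> K).

Let kernel_fun (u : hilb K A) : hilb K B := [ffun b => \sum_a M b a * u a].

Fact kernel_fun_linear : linear kernel_fun.
Proof.
move=> c u v; apply/ffunP => b; rewrite !ffunE scaler_sumr -big_split.
by apply: eq_bigr => a _; rewrite !ffunE mulrDr; congr (_ + _); apply: mulrCA.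
Qed.

HB.instance Definition _ :=
  GRing.isLinear.Build K (hilb K A) (hilb K B) *:%R kernel_fun kernel_fun_linear.

Definition kernel_op : 'Hom(hilb K A, hilb K B) := linfun kernel_fun.

Lemma kernel_opE u b : kernel_op u b = \sum_a M b a * u a.
Proof. by rewrite lfunE ffunE. Qed.

End KernelOp.

Implicit Types A B : finType.

Lemma kernel_op_adjoint A B (M : B -> A -> K) u v :
  dotp (kernel_op M u) v = dotp u (kernel_op (fun a b => (M b a)^*) v).
Proof.
rewrite /dotp; under eq_bigr => b _ do rewrite kernel_opE rmorph_sum mulr_suml.
rewrite exchange_big; apply: eq_bigr => a _; rewrite kernel_opE mulr_sumr.
by apply: eq_bigr => b _; rewrite rmorphM mulrCA mulrA.
Qed.

Lemma dotpBr A (u v w : hilb K A) : dotp u (v - w) = dotp u v - dotp u w.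
Proof.
by rewrite /dotp -sumrB; apply: eq_bigr => a _; rewrite !ffunE mulrBr.
Qed.

(** Moving V to the other side turns <V u, v - V V' v> into <u, V' v - V' V V' v>, which vanishes
    since V' V = 1. *)
Lemma isometry_orth_projector A B (V : 'Hom(hilb K A, hilb K B))
    (V' : 'Hom(hilb K B, hilb K A)) :
    (forall u v, dotp (V u) v = dotp u (V' v)) -> cancel V V' ->
  orth_projector (limg V) (V \o V')%VF.
Proof.
move=> adjV VK v; rewrite comp_lfunE memv_img ?memvf //; split=> // w.
by case/memv_imgP=> u _ ->; rewrite dotpBr !adjV VK subrr.
Qed.

Lemma permutation_unitary A (h : A -> A) : bijective h ->
  unitary (kernel_op (fun s t => (s == h t)%:R)).
Proof.
case=> h' hK h'K.
have UE u s : kernel_op (fun s t => (s == h t)%:R) u s = u (h' s).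
  rewrite kernel_opE (bigD1 (h' s)) //= h'K eqxx mul1r big1 ?addr0 // => t ts.
  rewrite (_ : s == h t = false) ?mul0r //.
  by apply: contraNF ts => /eqP ->; rewrite hK.
split=> [u v|v].
  rewrite /dotp (reindex_inj (can_inj hK)); apply: eq_bigr => s _.
  by rewrite !UE hK.
exists [ffun s => v (h s)]; apply/ffunP => s.
by rewrite UE ffunE h'K.
Qed.

End Kernels.

(** * Knill-Laflamme condition for codes given by a permutation of basis states *)

(* |x> is encoded as q^(-c/2) \sum_y |g x y>|y>, where the sum over y runs over
   the halves of the maximally entangled pairs. *)
Section PermutationCode.

Variables (K : numClosedFieldType) (q n k c : nat).
Variable g : word q 'I_k -> word q 'I_c -> word q 'I_n.
Hypothesis g_inj : injective (fun xy => g xy.1 xy.2).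
Hypothesis q_gt0 : (0 < q)%N.
(** The middle 0 counts the ancillas, in the form that [initial_state] expects. *)
Hypothesis kcn : (k + 0 + c)%N = n.

Let amp : K := (sqrtC q%:R)^-1 ^+ c.

Let ampJ : amp^* = amp.
Proof. by rewrite geC0_conj // exprn_ge0 // invr_ge0 sqrtC_ge0 ler0n. Qed.

Let amp2 : amp * amp *+ q ^ c = 1.
Proof.
rewrite /amp -exprMn -invfM -expr2 sqrtCK -mulr_natr natrX -exprMn mulVf ?expr1n //.
by rewrite pnatr_eq0 -lt0n.
Qed.

Let encoder : 'Hom(qudits K q 'I_k, hilb K (word q 'I_n * word q 'I_c)%type) :=
  kernel_op (fun wy x => amp * (wy.1 == g x wy.2)%:R).

Let decoder := kernel_op (fun x (wy : word q 'I_n * word q 'I_c) =>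
  (amp * (wy.1 == g x wy.2)%:R : K)^*).

Let encoderE psi w y :
  encoder psi (w, y) = amp * \sum_x (w == g x y)%:R * psi x.
Proof.
by rewrite kernel_opE mulr_sumr; apply: eq_bigr => x _; rewrite mulrA.
Qed.

Let decoderE phi x : decoder phi x = amp * \sum_y phi (g x y, y).
Proof.
rewrite kernel_opE (eq_bigr (fun wy => amp * ((wy.1 == g x wy.2)%:R * phi (wy.1, wy.2)))).
  rewrite -mulr_sumr -(pair_bigA _ (fun w y => (w == g x y)%:R * phi (w, y))) /=.
  rewrite exchange_big; congr (_ * _); apply: eq_bigr => y _.
  rewrite (bigD1 (g x y)) //= eqxx mul1r big1 ?addr0 // => w /negPf ->.
  by rewrite mul0r.
by case=> w y _; rewrite rmorphM /= ampJ conjC_nat mulrA.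
Qed.

(** The receiver's word y is untouched by E (x) I, so only entries of E between [g x' y] and [g x y]
    with the same y occur. *)
Let sandwichE (E : 'End(qudits K q 'I_n)) psi x :
  decoder (tensI (word q 'I_c) E (encoder psi)) x =
  \sum_x' (amp * amp * \sum_y E (ket K (g x' y)) (g x y)) * psi x'.
Proof.
rewrite decoderE.
have slice y : [ffun w => encoder psi (w, y)] =
    \sum_x' (amp * psi x') *: (ket K (g x' y) : qudits K q 'I_n).
  apply/ffunP => w; rewrite ffunE encoderE sum_ffunE mulr_sumr.
  by apply: eq_bigr => x' _; rewrite !ffunE [RHS]mulrAC mulrA.
under eq_bigr => y _.
  rewrite tensIE slice linear_sum sum_ffunE.
  under eq_bigr => x' _ do rewrite linearZ ffunE.
  over.
rewrite exchange_big mulr_sumr; apply: eq_bigr => x' _.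
rewrite !mulr_sumr mulr_suml; apply: eq_bigr => y _.
by rewrite [_ *: _]mulrC !mulrA [RHS]mulrAC -!mulrA; congr (_ * _); rewrite mulrC -mulrA.
Qed.

(** The case E = 1 of [sandwichE]: injectivity of [g] kills the off-diagonal entries, and each
    diagonal one is a sum of q^c equal terms, normalised by [amp2]. *)
Let encoderK : cancel encoder decoder.
Proof.
move=> psi; apply/ffunP => x.
have -> : encoder psi = tensI (word q 'I_c) \1%VF (encoder psi).
  by apply/ffunP => -[w y]; rewrite tensIE id_lfunE ffunE.
rewrite sandwichE (bigD1 x) //= [X in _ + X]big1 => [|x' x'x].
  rewrite addr0 (eq_bigr (fun=> 1)) => [|y _]; last by rewrite id_lfunE ffunE eqxx.
  by rewrite sumr_const card_ffun !card_ord mulr_natr amp2 mul1r.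
rewrite big1 ?mulr0 ?mul0r // => y _; rewrite id_lfunE ffunE.
case: eqP => // /(g_inj (x1 := (x, y)) (x2 := (x', y))) [xx'].
by rewrite xx' eqxx in x'x.
Qed.

Let data_of (w : word q 'I_n) : word q 'I_k :=
  [ffun i => w (cast_ord kcn (lshift c (lshift 0 i)))].
Let pair_of (w : word q 'I_n) : word q 'I_c :=
  [ffun j => w (cast_ord kcn (rshift (k + 0) j))].

Let split_word w := (data_of w, pair_of w).

Let split_word_bij : bijective split_word.
Proof.
apply: inj_card_bij => [w w' [] /ffunP ww'1 /ffunP ww'2|]; last first.
  by rewrite card_prod !card_ffun !card_ord -expnD -kcn addn0.
apply/ffunP => i; have -> : i = cast_ord kcn (cast_ord (esym kcn) i) by rewrite cast_ordKV.
case: (split_ordP (cast_ord (esym kcn) i)) => [j ->|j ->].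
  case: (split_ordP j) => [l ->|[] //].
  by have := ww'1 l; rewrite !ffunE.
by have := ww'2 j; rewrite !ffunE.
Qed.

(** The permutation of the sender's basis states behind the unitary [preparation]: data and pair
    halves (x, y) go to [g x y]. *)
Let shuffle w := g (data_of w) (pair_of w).

Let shuffle_bij : bijective shuffle.
Proof.
apply: injF_bij => w w' /(g_inj (x1 := split_word w) (x2 := split_word w')).
exact: bij_inj.
Qed.

Let preparation : 'End(qudits K q 'I_n) :=
  kernel_op (fun s t => (s == shuffle t)%:R).

Let prod_Phi (s t : word q 'I_c) : \prod_j Phi K (s j) (t j) = amp * (s == t)%:R.
Proof.
rewrite big_split prodr_const card_ord /=; congr (_ * _).
have [->|st] := eqVneq s t; first by rewrite big1 // => j _; rewrite eqxx.
have [j stj] : exists j, s j != t j.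
  apply/existsP; apply: contraNT st => /existsPn st.
  by apply/eqP/ffunP => j; apply/eqP/negPn.
by rewrite (bigD1 j) //= (negPf stj) mul0r.
Qed.

(** The c pairs contribute [amp] times the indicator that the sender's halves equal y. Reindexing by
    [split_word] makes the sum run over data and halves, and the indicator collapses the latter. *)
Let encoder_prep psi :
  encoder psi = tensI (word q 'I_c) preparation (initial_state kcn psi).
Proof.
apply/ffunP => -[w y]; rewrite tensIE encoderE kernel_opE.
rewrite (eq_bigr (fun w' => let xy := split_word w' in
  amp * ((w == g xy.1 xy.2)%:R * psi xy.1 * (xy.2 == y)%:R))); last first.
  move=> w' _; rewrite !ffunE /= big_ord0 mulr1 -/(data_of w').
  rewrite (eq_bigr (fun j => Phi K (pair_of w' j) (y j))) => [|j _]; last by rewrite !ffunE.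
  by rewrite prod_Phi [LHS]mulrA [LHS]mulrCA.
rewrite -(reindex split_word (P := xpredT)
  (F := fun xy => amp * ((w == g xy.1 xy.2)%:R * psi xy.1 * (xy.2 == y)%:R))); last exact: onW_bij.
rewrite -(pair_bigA _ (fun x y' => amp * ((w == g x y')%:R * psi x * (y' == y)%:R))) /= mulr_sumr.
apply: eq_bigr => x _; rewrite (bigD1 y) //= eqxx mulr1 big1 ?addr0 // => y' /negPf ->.
by rewrite !mulr0.
Qed.

(** The first hypothesis kills the off-diagonal entries of the error between codewords; a common y
    suffices there, since the receiver's halves are error-free. The second makes the diagonal
    entries equal, by reindexing the sum over y along [t]. *)
Lemma permutation_code_eaqecc d :
    (forall (S : {set 'I_n}) x x' y, (#|S| < d)%N ->
       (forall i, i \notin S -> g x y i = g x' y i) -> x = x') ->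
    (forall (S : {set 'I_n}) x x', (#|S| < d)%N ->
       exists2 t, injective t &
         forall y i, i \in S -> g x (t y) i = g x' y i) ->
  exists Q : {vspace hilb K (word q 'I_n * word q 'I_c)%type}, eaqecc k d Q.
Proof.
move=> detect mix; exists (limg encoder); split.
  exists 0%N, kcn, preparation; split; first exact: permutation_unitary.
  move=> phi; split=> [/memv_imgP[psi _ ->]|[psi ->]].
    by exists psi; apply: encoder_prep.
  by rewrite -encoder_prep memv_img ?memvf.
exists (encoder \o decoder)%VF; split.
  by apply: isometry_orth_projector => // u v; apply: kernel_op_adjoint.
move=> S E Sd [A EA].
(* The diagonal entry is independent of x, so the scalar is read off at the all-zero data word. *)
pose x0 : word q 'I_k := [ffun=> Ordinal q_gt0].
pose lam := amp * amp * \sum_y A (ket K (restr S (g x0 y))) (restr S (g x0 y)).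
exists lam; apply/lfunP => phi; rewrite !comp_lfunE scale_lfunE comp_lfunE -linearZ.
congr (encoder _); set psi := decoder phi; apply/ffunP => x.
rewrite sandwichE (bigD1 x) //= [X in _ + X]big1 => [|x' x'x].
  rewrite addr0 !ffunE; congr (_ * _ * _).
  have [t t_inj tP] := mix S x0 x Sd.
  rewrite [RHS](reindex_inj t_inj); apply: eq_bigr => y _.
  have -> : restr S (g x0 (t y)) = restr S (g x y).
    by apply/ffunP => -[i iS]; rewrite !ffunE tP.
  by rewrite EA (_ : [forall _ in _, _]) ?mulr1 //; apply/forall_inP.
rewrite big1 ?mulr0 ?mul0r // => y _; rewrite EA.
case: forall_inP => [agree|]; last by rewrite mulr0.
case/eqP: x'x; apply/esym/(detect S x x' y) => // i iS.
by apply/eqP/agree; rewrite inE.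
Qed.

End PermutationCode.

(** * The codes obtained from an LCD code and from its dual *)

Lemma lcd_eaqecc (K : numClosedFieldType) (F : finFieldType) (n k c d : nat)
    (C : {vspace 'rV[F]_n}) :
  \dim C = k -> \dim (dual_code C) = c -> min_distance C d -> lcd C ->
  exists Q : {vspace hilb K (word #|F| 'I_n * word #|F| 'I_c)%type}, eaqecc k d Q.
Proof.
move=> dimC dimD dC lcdC.
have [f f_inj fP] := vspace_param dimC; have [h h_inj hP] := vspace_param dimD.
have fC x : f x \in C by apply/fP; exists x.
have hD y : h y \in dual_code C by apply/hP; exists y.
pose g x y : word #|F| 'I_n := [ffun i => enum_rank ((f x + h y) 0 i)].
have gE x y x' y' i : g x y i = g x' y' i -> (f x + h y) 0 i = (f x' + h y') 0 i.
  by rewrite !ffunE => /enum_rank_inj.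
apply: (@permutation_code_eaqecc _ _ _ _ _ g).
- move=> [x y] [x' y'] /= gxy.
  have fh : f x + h y = f x' + h y' by apply/rowP => i; apply: gE; rewrite gxy.
  have fhB : f x - f x' = h y' - h y.
    by apply/eqP; rewrite subr_eq addrAC -subr_eq opprK fh addrC.
  (* The difference of the C-parts is also a difference of dual parts, hence zero by the LCD
     property. *)
  have : f x - f x' \in (C :&: dual_code C)%VS.
    by rewrite memv_cap {2}fhB !rpredB.
  rewrite [X in _ \in pred_of_vspace X]lcdC memv0 => /eqP fx0.
  congr (_, _); [apply: f_inj | apply/esym/h_inj]; apply/eqP.
    by rewrite -subr_eq0 fx0.
  by rewrite -subr_eq0 -fhB fx0.
- by apply/card_gt0P; exists 0.
- by rewrite addn0 -dimC -dimD dim_lcd_dual_code.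
- move=> S x x' y Sd gS; apply: f_inj.
  apply: (min_distance_eq dC Sd) => // i /gS/gE.
  by rewrite !mxE => /addIr.
- move=> S x x' Sd.
  (* On [S], adding [w] to [f x] gives [f x']; [t] is translation by [w], read in the coordinates of
     the dual. *)
  have [w wD wS] := lcd_dual_code_interpolation (f x' - f x) lcdC dC Sd.
  have /fin_all_exists[t tP] y : exists y', h y' = h y + w.
    by apply/hP; rewrite memvD ?hD.
  exists t => [y y' tyy'|y i iS].
    by apply/h_inj/(addIr w); rewrite -!tP tyy'.
  rewrite !ffunE tP; congr enum_rank.
  by rewrite !mxE (wS i iS) !mxE addrA addrAC subrKC.
Qed.

Theorem proposition5p2 (R : realType) (p r q : nat) (F : finFieldType)
    (n k d : nat) (C : {vspace 'rV[F]_n}) :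
  prime p -> (0 < r)%N -> q = (p ^ r)%N -> #|F| = q ->
  linear_code k d C -> lcd C ->
  (exists Q : {vspace hilb R[i] (word q 'I_n * word q 'I_(n - k))%type},
     maximal_entanglement k d Q) /\
  (forall dperp : nat, min_distance (dual_code C) dperp ->
   exists Q : {vspace hilb R[i] (word q 'I_n * word q 'I_k)%type},
     maximal_entanglement (n - k) dperp Q).
Proof.
move=> _ _ _ <- [dimC dC] lcdC.
have dimD : \dim (dual_code C) = (n - k)%N.
  by rewrite -[X in (X - _)%N](dim_lcd_dual_code lcdC) dimC addKn.
have dimDD : \dim (dual_code (dual_code C)) = k by rewrite lcd_dual_codeK.
have le_kn : (k <= n)%N by rewrite -(dim_lcd_dual_code lcdC) dimC leq_addr.
split=> [|dperp dD].
  by have [Q QP] := lcd_eaqecc R[i] dimC dimD dC lcdC; exists Q.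
(* The roles of C and its dual are exchanged. The number k of pairs has to be recognised as n - (n -
   k), which rests on [le_kn]. *)
have [Q QP] := lcd_eaqecc R[i] dimD dimDD dD (lcd_dual_code lcdC).
by exists Q; split; rewrite ?subKn.
Qed.
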